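(* If $\mu$ is a probability measure on $\mathbb{Z}$ and the spectrum of $\mu$ is contained in some Stolz region, then for every sequence of positive integers $(n_k)_{k\ge1}$ satisfying $n_k\le n_{k+1}$ for all $k$, there is some constant $C$ such that $$\sup_{|\gamma|=1}\sum_{k=1}^\infty\left|\widehat\mu(\gamma)^{n_{k+1}}-\widehat\mu(\gamma)^{n_k}\right|\le C.$$
   Context: $\widehat\mu(\gamma)=\sum_{s\in\mathbb{Z}}\mu(s)\gamma^s$ for $\gamma\in\mathbb{C}$, $|\gamma|=1$. The spectrum of $\mu$ is the set of values $\{\widehat\mu(\gamma):|\gamma|=1\}$. The spectrum being contained in a Stolz region means that there is a finite constant $C_0$ such that $|1-\widehat\mu(\gamma)|\le C_0\,(1-|\widehat\mu(\gamma)|)$ for all $|\gamma|=1$. *)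

(* Defs.v *)
From HB Require Import structures.
From mathcomp Require Import all_boot all_order all_algebra.
From mathcomp Require Import all_classical all_reals all_analysis.
From mathcomp Require Import complex.
From mathcomp.analysis Require Import showcase.summability.

Set Implicit Arguments.
Unset Strict Implicit.
Unset Printing Implicit Defensive.

Import Order.TTheory GRing.Theory Num.Theory.
Import numFieldNormedType.Exports.

Local Open Scope ring_scope.
Local Open Scope classical_set_scope.
Local Open Scope complex_scope.

HB.instance Definition _ := isPointed.Build int 0%R.

(* As for nat in the library, every subset of int is measurable. *)
HB.instance Definition _ := @isMeasurable.Build default_measure_display
  int discrete_measurable discrete_measurable0
  discrete_measurableC discrete_measurableU.

(* The modulus is taken as the real number normc z; the generic norm `|z| on
   R[i] is this number embedded in R[i]. *)
Definition unit_circle (R : realType) : set R[i] :=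
  [set g | Normc.normc g = 1].

(* The family is indexed by int and summed unconditionally (limit along the
   filter of finite subsets of int) in the normed space R[i]. *)
Definition fourier (R : realType) (mu : probability int R) (g : R[i]) : R[i] :=
  sum (fun s : int => ((fine (mu [set s]))%:C * g ^ s : R[i]^o)).

Definition spectrum (R : realType) (mu : probability int R) : set R[i] :=
  fourier mu @` @unit_circle R.

Definition stolz_region (R : realType) (C0 : R) : set R[i] :=
  [set z | Normc.normc (1 - z) <= C0 * (1 - Normc.normc z)].

(* Main.v *)
Require Import Defs.
From HB Require Import structures.
From mathcomp Require Import all_boot all_order all_algebra.
From mathcomp Require Import all_classical all_reals all_analysis.
From mathcomp Require Import complex.
From mathcomp Require Import finmap ring lra.
From mathcomp.analysis Require Import showcase.summability.

Set Implicit Arguments.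
Unset Strict Implicit.
Unset Printing Implicit Defensive.

Import Order.TTheory GRing.Theory Num.Theory.
Import numFieldNormedType.Exports.

Local Open Scope ring_scope.
Local Open Scope classical_set_scope.

(** The Stolz condition turns the variation of the powers of z into that of
    the powers of its modulus r = |z|.  A single step satisfies
    |z^(j+1) - z^j| = r^j |1 - z| <= C (1 - r) r^j = C (r^j - r^(j+1)),
    and summing these estimates over a <= j < b gives
    |z^b - z^a| <= C (r^a - r^b) ([stolz_power_diff]).  For nondecreasing
    exponents n_k the right-hand sides telescope, so every partial sum of the
    variation is at most C (r^(n_1) - r^(n_m)), hence at most |C| as soon as
    r <= 1 ([stolz_variation]).  This bound is the same for all
    z in the Stolz region.

    It is applied at z = fourier mu g.  That this number has modulus at most 1
    ([normc_fourier_le1]) holds because a finite part of its series has modulus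
    at most the mu-mass of the finitely many integers involved. *)

Section StolzEstimate.
Variable R : rcfType.
Implicit Types (z : R[i]) (C : R).
Local Notation normc := Normc.normc.

Lemma normcX z k : normc (z ^+ k) = normc z ^+ k.
Proof.
elim: k => [|k IHk]; first by rewrite !expr0 Normc.normc1.
by rewrite !exprS Normc.normcM IHk.
Qed.

Lemma normc_ge0 z : 0 <= normc z.
Proof. by case: z => a b; exact: sqrtr_ge0. Qed.

Lemma normc_distC z (w : R[i]) : normc (z - w) = normc (w - z).
Proof. by rewrite -opprB normcN. Qed.

(** Induction on b peels off one factor: the step from b to b + 1 costs
    r^b |1 - z|, which the hypothesis bounds by C (r^b - r^(b+1)),
    r being the modulus of z. *)
Lemma stolz_power_diff C z a b :
    normc (1 - z) <= C * (1 - normc z) -> (a <= b)%N ->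
  normc (z ^+ b - z ^+ a) <= C * (normc z ^+ a - normc z ^+ b).
Proof.
move=> hz; elim: b => [|b IHb].
  by rewrite leqn0 => /eqP ->; rewrite !subrr Normc.normc0 mulr0.
rewrite leq_eqVlt => /predU1P[->|].
  by rewrite !subrr Normc.normc0 mulr0.
rewrite ltnS => /IHb {}IHb.
have -> : z ^+ b.+1 - z ^+ a = z ^+ b * (z - 1) + (z ^+ b - z ^+ a).
  by rewrite exprSr; ring.
have -> : C * (normc z ^+ a - normc z ^+ b.+1)
    = normc z ^+ b * (C * (1 - normc z)) + C * (normc z ^+ a - normc z ^+ b).
  by rewrite exprSr; ring.
apply: le_trans (le_normcD _ _) (lerD _ IHb).
by rewrite Normc.normcM normcX normc_distC ler_wpM2l ?exprn_ge0 ?normc_ge0.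
Qed.

(** The bound is |C| rather than C because C may be negative: for z in the
    unit disc the Stolz condition then forces z = 1, where the sum is 0 > C. *)
Lemma stolz_variation C z (n : nat -> nat) (m : nat) :
    (forall k, (1 <= k)%N -> (n k <= n k.+1)%N) ->
    normc (1 - z) <= C * (1 - normc z) -> normc z <= 1 ->
  \sum_(1 <= k < m) normc (z ^+ n k.+1 - z ^+ n k) <= `|C|.
Proof.
move=> nmono hz z1.
have [m1|m1] := leqP m 1; first by rewrite big_geq.
have powle k : 0 <= normc z ^+ k <= 1.
  by rewrite exprn_ge0 ?normc_ge0 //= exprn_ile1 ?normc_ge0.
apply: (@le_trans _ _ (C * (normc z ^+ n 1%N - normc z ^+ n m))).
  rewrite -[X in C * X]opprB -(telescope_sumr (fun k => normc z ^+ n k) (ltnW m1)) -sumrN.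
  rewrite mulr_sumr big_nat [leRHS]big_nat; apply: ler_sum => k /andP[k1 _].
  by rewrite opprB; exact/stolz_power_diff/nmono.
apply: le_trans (ler_norm _) _; rewrite normrM ler_piMr //.
have /andP[x0 x1] := powle (n 1%N); have /andP[y0 y1] := powle (n m).
by rewrite ler_norml; apply/andP; split; lra.
Qed.

End StolzEstimate.

Section FourierBound.
Variables (R : realType) (mu : probability int R).
Local Notation normc := Normc.normc.

(** Distinct atoms are disjoint, so the sum is the mass of a finite set. *)
Lemma sum_atoms_le1 (A : {fset int}) :
  \sum_(s <- A) fine (mu [set s]) <= 1.
Proof.
have meas (B : set int) : measurable B by [].
rewrite -lee_fin -sumEFin.
under eq_bigr do rewrite fineK ?fin_num_measure//.
rewrite -measure_fbigsetU //; first exact: probability_le1.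
by move=> i j _ _ [x [-> ->]].
Qed.

Lemma normc_partial_sum_le1 (g : R[i]) (A : {fset int}) : normc g = 1 ->
  normc (partial_sum (fun s : int => ((fine (mu [set s]))%:C%C * g ^ s)) A) <= 1.
Proof.
move=> g1.
have gX (s : int) : normc (g ^ s) = 1.
  by case: s => k; rewrite ?NegzE ?exprnN ?Normc.normcV -?exprnP normcX g1 expr1n ?invr1.
apply: le_trans (sum_atoms_le1 A); rewrite /partial_sum [leRHS]big_seq_fsetE /=.
(* Triangle inequality; the term of index s has modulus mu {s}. *)
elim/big_ind2: _ => [|x x' y y' hx hy|s _]; first by rewrite Normc.normc0.
  exact: le_trans (le_normcD _ _) (lerD hx hy).
rewrite Normc.normcM gX mulr1 /= expr0n addr0 sqrtr_sqr ger0_norm //.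
exact: fine_ge0.
Qed.

(** The bound passes from the partial sums to the limit: a limit of modulus
    1 + e > 1 would have a partial sum within e of it, hence of modulus > 1. *)
Lemma normc_fourier_le1 (g : R[i]) : unit_circle g -> normc (fourier mu g) <= 1.
Proof.
move=> g1; rewrite /fourier /sum.
set F := (X in lim X).
(* Without convergence the limit takes the default value 0. *)
have [cvF|dvF] := pselect (cvg F); last first.
  by rewrite (dvgP dvF) Normc.normc0.
rewrite leNgt; apply/negP => lim_gt1.
have e0 : 0 < (normc (lim F) - 1)%:C%C :> R[i] by rewrite ltcR subr_gt0.
have totallyF := @totally_filter int.
have /cvgrPdist_lt /(_ _ e0) near_lim := cvF.
have [A /= dist] := filter_ex near_lim.
have := le_lt_trans (lerB_dist _ _) dist.
rewrite -[_ - `|_|]rmorphB ltcR.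
have := normc_partial_sum_le1 A g1.
lra.
Qed.

End FourierBound.

Theorem lemma4p2 (R : realType) (mu : probability int R)
    (hstolz : exists C0 : R, spectrum mu `<=` stolz_region C0)
    (n : nat -> nat)
    (npos : forall k, (1 <= k)%N -> (0 < n k)%N)
    (nmono : forall k, (1 <= k)%N -> (n k <= n k.+1)%N) :
  exists C : R,
    (ereal_sup [set (\sum_(1 <= k <oo)
        (Normc.normc (fourier mu g ^+ n k.+1 - fourier mu g ^+ n k))%:E)%E
      | g in @unit_circle R] <= C%:E)%E.
Proof.
have [C stolzC] := hstolz; exists `|C|; apply: ge_ereal_sup => _ [g g1 <-].
apply: lime_le; first by apply: is_cvg_nneseries => k _ _; rewrite lee_fin normc_ge0.
apply: nearW => m; rewrite sumEFin lee_fin; apply: stolz_variation => //.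
  by apply: stolzC; exists g.
exact: normc_fourier_le1.
Qed.
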